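(* Let $\ell\ge 1$. The function $\phi:B_\ell\to C_\ell$ is a bijection. That is, for integers $m\ge n\ge 0$ with $m+n=\ell$, $\phi$ gives a one-to-one correspondence between the merging paths (arrival sequences of length $\ell$) reaching the point $(n,m)$ and the heads/tails sequences $\mathbf{c}\in C_\ell$ with $\max(\mathbf{c})=m$.
   Context: An arrival sequence of length $\ell$ is a binary string $\mathbf{b}=b_1b_2\cdots b_\ell\in\{0,1\}^\ell$; $B_\ell$ is the set of all of them. Cars $1,2,\dots,\ell$ arrive in order and choose between two initially empty lanes (left and right): if $b_i=0$, car $i$ enters the right lane; if $b_i=1$, car $i$ enters the currently shorter lane, and enters the right lane if both lanes have the same length. Position $i$ is called a bounce of $\mathbf{b}$ if $b_i=1$ and car $i$ enters the right lane. The merging path of $\mathbf{b}$ is the lattice path from $(0,0)$ whose $i$-th step is an up step $(0,1)$ if car $i$ enters the right lane (decorated if $i$ is a bounce) and a right step $(1,0)$ if car $i$ enters the left lane; merging paths are in bijection with arrival sequences. It reaches (ends at) $(n,m)$ when $n$ cars are in the left lane and $m$ are in the right lane, $m+n=\ell$. The parity vector $\mathbf{p}(\mathbf{b})=p_1p_2\cdots p_\ell\in\{0,1\}^\ell$ is defined by $p_1=0$ and, for $1\le i\le \ell-1$, $p_{i+1}=1-p_i$ if position $i$ is a bounce of $\mathbf{b}$, and $p_{i+1}=p_i$ otherwise. $C_\ell$ is the set of sequences of $\ell$ coin flips, identified with $\{0,1\}^\ell$ via $0=$ heads, $1=$ tails. For $\mathbf{c}\in C_\ell$, $\max(\mathbf{c})$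 is the maximum of the number of heads and the number of tails in $\mathbf{c}$. The map $\phi:B_\ell\to C_\ell$ is $\phi(\mathbf{b})=\mathbf{b}+\mathbf{p}(\mathbf{b})$, with entrywise addition modulo $2$. *)

(* Defs.v *)
From mathcomp Require Import all_boot.

Set Implicit Arguments.
Unset Strict Implicit.
Unset Printing Implicit Defensive.

(* Positions are numbered from 0 (car i.+1 arrives at position i). An arrival
   sequence or coin-flip sequence of length l is an [l.-tuple bool], with
   false = 0 = heads and true = 1 = tails. *)

(* [s] = (number of cars in the left lane, number of cars in the right lane). *)
Definition enters_right (s : nat * nat) (x : bool) : bool :=
  if x then s.2 <= s.1 else true.

Definition arrive (s : nat * nat) (x : bool) : nat * nat :=
  if enters_right s x then (s.1, s.2.+1) else (s.1.+1, s.2).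

Definition lanes (b : seq bool) : nat * nat := foldl arrive (0, 0) b.

Definition car_right (b : seq bool) (i : nat) : bool :=
  enters_right (lanes (take i b)) (nth false b i).

Definition bounce (b : seq bool) (i : nat) : bool :=
  nth false b i && car_right b i.

(* The boolean argument of [UpStep] records whether the step is decorated. *)
Inductive step := UpStep of bool | RightStep.

Definition merging_path (b : seq bool) : seq step :=
  mkseq (fun i => if car_right b i then UpStep (bounce b i) else RightStep)
        (size b).

Definition move (z : nat * nat) (s : step) : nat * nat :=
  match s with
  | UpStep _ => (z.1, z.2.+1)
  | RightStep => (z.1.+1, z.2)
  end.

Definition endpoint (p : seq step) : nat * nat := foldl move (0, 0) p.

Fixpoint parity (b : seq bool) (i : nat) : bool :=
  match i with
  | 0 => false
  | j.+1 => if bounce b j then ~~ parity b j else parity b j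
  end.

Definition parity_vector (l : nat) (b : l.-tuple bool) : l.-tuple bool :=
  [tuple parity b i | i < l].

(* [addb], written (+), is addition modulo 2. *)
Definition phi (l : nat) (b : l.-tuple bool) : l.-tuple bool :=
  [tuple tnth b i (+) tnth (parity_vector b) i | i < l].

Definition heads (c : seq bool) : nat := count_mem false c.
Definition tails (c : seq bool) : nat := count_mem true c.
Definition max_flips (c : seq bool) : nat := maxn (heads c) (tails c).

(* Main.v *)
Require Import Defs.
From mathcomp Require Import all_boot zify.

Set Implicit Arguments.
Unset Strict Implicit.
Unset Printing Implicit Defensive.

(* As long as the parity is 0, a head sends the next car to the right lane and
   a tail to the left one; a bounce, which only occurs when the lanes have equal
   length, exchanges the two roles. Hence the right lane, never the shorter one,
   always counts the more frequent side of the coin. Injectivity holds because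
   the parity at a position depends only on the earlier arrivals. *)

Lemma lanes_rcons (b : seq bool) (x : bool) :
  lanes (rcons b x) = arrive (lanes b) x.
Proof. by rewrite /lanes foldl_rcons. Qed.

Lemma car_right_rcons (b : seq bool) (x : bool) (i : nat) :
  i < size b -> car_right (rcons b x) i = car_right b i.
Proof.
by move=> ib; rewrite /car_right nth_rcons ib -cats1 takel_cat // ltnW.
Qed.

Lemma car_right_last (b : seq bool) (x : bool) :
  car_right (rcons b x) (size b) = enters_right (lanes b) x.
Proof.
by rewrite /car_right nth_rcons ltnn eqxx -cats1 take_size_cat.
Qed.

Lemma bounce_rcons (b : seq bool) (x : bool) (i : nat) :
  i < size b -> bounce (rcons b x) i = bounce b i.
Proof. by move=> ib; rewrite /bounce car_right_rcons // nth_rcons ib. Qed.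

Lemma bounce_last (b : seq bool) (x : bool) :
  bounce (rcons b x) (size b) = x && enters_right (lanes b) x.
Proof. by rewrite /bounce car_right_last nth_rcons ltnn eqxx. Qed.

Lemma parity_rcons (b : seq bool) (x : bool) (i : nat) :
  i <= size b -> parity (rcons b x) i = parity b i.
Proof.
elim: i => [|i IHi] //= ib.
by rewrite bounce_rcons // IHi // ltnW.
Qed.

(** The decoration is [x] itself: once the new car enters the right lane, it bounces exactly when
    [x] is true. *)
Lemma merging_path_rcons (b : seq bool) (x : bool) :
  merging_path (rcons b x) =
  rcons (merging_path b)
    (if enters_right (lanes b) x then UpStep x else RightStep).
Proof.
rewrite /merging_path size_rcons mkseqS car_right_last bounce_last.
congr rcons; last by case: ifP => [->|//]; rewrite andbT.
apply/eq_in_map => i; rewrite mem_iota add0n => /andP[_ ib].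
by rewrite car_right_rcons // bounce_rcons.
Qed.

Lemma endpoint_merging_path (b : seq bool) :
  endpoint (merging_path b) = lanes b.
Proof.
elim/last_ind: b => [|b x IHb] //.
rewrite merging_path_rcons lanes_rcons /endpoint foldl_rcons.
rewrite -/(endpoint _) IHb /arrive.
by case: (enters_right _ _).
Qed.

(** [phi] freed from the length index, so that inductions can append one car at a time. *)
Definition flips (b : seq bool) : seq bool :=
  mkseq (fun i => nth false b i (+) parity b i) (size b).

Lemma size_flips (b : seq bool) : size (flips b) = size b.
Proof. exact: size_mkseq. Qed.

Lemma flips_rcons (b : seq bool) (x : bool) :
  flips (rcons b x) = rcons (flips b) (x (+) parity b (size b)).
Proof.
rewrite /flips size_rcons mkseqS nth_rcons ltnn eqxx parity_rcons //.
congr rcons; apply/eq_in_map => i; rewrite mem_iota add0n => /andP[_ ib].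
by rewrite nth_rcons ib parity_rcons // ltnW.
Qed.

Lemma flips_inj : injective flips.
Proof.
elim/last_ind => [|b x IHb] b' eq_bb'; have := congr1 size eq_bb';
  rewrite !size_flips; first by case: b' {eq_bb'}.
case/lastP: b' eq_bb' => [|b' x']; first by rewrite size_rcons.
(* Equal prefixes give equal last parities, which then cancel. *)
rewrite !flips_rcons => /rcons_inj[/IHb <- eq_x] _.
by rewrite (addIb eq_x).
Qed.

Lemma phiE (l : nat) (b : l.-tuple bool) : phi b = flips b :> seq bool.
Proof.
apply: (@eq_from_nth _ false); first by rewrite size_flips !size_tuple.
move=> i; rewrite size_tuple => il; rewrite nth_mkseq ?size_tuple //.
(* Viewing [i] as an ordinal lets the [tnth] lemmas compute both tuples. *)
have -> : i = Ordinal il by [].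
by rewrite -tnth_nth !tnth_mktuple -tnth_nth.
Qed.

Lemma phi_inj (l : nat) : injective (@phi l).
Proof.
by move=> b b' /(congr1 val) /=; rewrite !phiE => /flips_inj /val_inj.
Qed.

(** The index [size b] lies one past the parity vector: it gives the parity that the next car would
    meet, so the invariant already accounts for a bounce of the last car. The inequality is carried
    along because it forces equal lanes at a bounce, where the two counts may then be swapped. *)
Lemma lanes_flips (b : seq bool) :
  lanes b = (count_mem (~~ parity b (size b)) (flips b),
             count_mem (parity b (size b)) (flips b))
  /\ (lanes b).1 <= (lanes b).2.
Proof.
elim/last_ind: b => [|b x [IHb leLR]] //.
rewrite lanes_rcons flips_rcons size_rcons /= bounce_last parity_rcons //.
rewrite -!cats1 !count_cat /= /arrive.
case: (lanes b) IHb leLR => L R [eqL eqR] /= leLR.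
(* Only [x = true] needs the comparison of the lanes: [R <= L] is a bounce, and [L < R] leaves room
   for one more car on the left. *)
case: (parity _ _) eqL eqR => /= eqL eqR; case: x => //=;
  try case: leqP => /= ?; rewrite -eqL -eqR; split; try (congr pair); lia.
Qed.

Lemma max_flips_phi (l : nat) (b : l.-tuple bool) :
  max_flips (phi b) = (lanes b).2.
Proof.
have [-> /=] := lanes_flips b; rewrite phiE /max_flips /heads /tails.
by case: (parity _ _) => /= ?; [apply/maxn_idPr | apply/maxn_idPl].
Qed.

Lemma lanes_total (b : seq bool) : (lanes b).1 + (lanes b).2 = size b.
Proof.
elim/last_ind: b => [|b x IHb] //.
rewrite lanes_rcons size_rcons -IHb /arrive.
by case: (enters_right _ _); rewrite /= ?addnS.
Qed.

Theorem corollary3p7 (l : nat) (hl : 1 <= l) :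
  bijective (@phi l) /\
  forall m n : nat, n <= m -> m + n = l ->
    let B := [set b : l.-tuple bool | endpoint (merging_path b) == (n, m)] in
    let C := [set c : l.-tuple bool | max_flips c == m] in
    {in B &, injective (@phi l)} /\ [set phi b | b in B] = C.
Proof.
have bij_phi := injF_bij (@phi_inj l); split=> // m n _ mn_l B C.
split; first by move=> b b' _ _; apply: phi_inj.
(* As the lane lengths add up to [l], the right one alone determines the endpoint. *)
have BE b : (b \in B) = (phi b \in C).
  rewrite !inE endpoint_merging_path max_flips_phi.
  have := lanes_total b; rewrite size_tuple.
  case: (lanes b) => L R /= LR_l; rewrite xpair_eqE.
  by apply/andP/eqP => [[_ /eqP]|] //; lia.
(* Since [BE] is an equivalence, the global inverse [psi] maps [C] back into [B]. *)
case: bij_phi => psi _ psiK; apply/setP=> c; apply/imsetP/idP => [[b]|].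
  by rewrite BE => ? ->.
by move=> cC; exists (psi c); rewrite ?BE psiK.
Qed.
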